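(* Let $\mathcal{P}\colon \mathbb{C}\hookrightarrow\mathbb{E}$ be a projective cover of an exact category $\mathbb{E}$. Suppose that one of the following (equivalent) conditions holds: \begin{enumerate} \item[(a)] projective objects in $\mathbb{E}$ are internally projective; \item[(b)] the full subcategory $\mathrm{P}(\mathbb{E})$ of $\mathbb{E}$ on the projective objects (which is equivalent to the splitting of idempotents $\overline{\mathbb{C}}$ of $\mathbb{C}$) has binary products; \item[(c)] for every weak product $Z\xleftarrow{p_1}V\xrightarrow{p_2}X$ in $\mathbb{C}$ there is an idempotent $i\colon V\to V$ which is determined by projections and such that $p_1i=p_1$ and $p_2i=p_2$. \end{enumerate} Then $\mathbb{E}$ is cartesian closed if and only if $\mathbb{C}$ has weak simple products.
   Context: A category is exact if it has finite limits, regular epis are stable under pullback, and every equivalence relation $(r_1,r_2)\colon R\hookrightarrow X\times X$ has a coequaliser $q$ of $r_1,r_2$ such that $r_1,r_2$ is a kernel pair of $q$. An object $P$ of a category is (regular) projective if every arrow $P\to B$ lifts along every regular epi $A\to B$. A projective cover of an exact category $\mathbb{E}$ is (the inclusion $\mathcal{P}$ of) a full subcategory $\mathcal{P}\colon\mathbb{C}\hookrightarrow\mathbb{E}$ such that $\mathcal{P}X$ is projective in $\mathbb{E}$ for every $X$ in $\mathbb{C}$, and for every $A$ in $\mathbb{E}$ there are $X$ in $\mathbb{C}$ and a regular epi $\mathcal{P}X\to A$. In this situation $\mathbb{C}$ has weak finite limits. A weak limit is defined as a limit but without requiring uniqueness of the induced arrow. An object $P$ of a category with binary products is internally (regular) projective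 if for every object $C$, regular epi $r\colon A\to B$ and arrow $f\colon C\times P\to B$ there are an object $T$, a regular epi $t\colon T\to C$ and an arrow $f'\colon T\times P\to A$ with $rf'=f(t\times\mathrm{id}_P)$. An arrow $f\colon V\to Y$ out of a weak product $Z\xleftarrow{p_1}V\xrightarrow{p_2}X$ is determined by projections if, for all parallel arrows $h,k$ into $V$, $p_1h=p_1k$ and $p_2h=p_2k$ imply $fh=fk$. Weak simple product: given a span $Z\xleftarrow{g_1}Y\xrightarrow{g_2}X$ in $\mathbb{C}$, consider data $D=(W,w,V,q_1,q_2,e)$ where $w\colon W\to Z$, $W\xleftarrow{q_1}V\xrightarrow{q_2}X$ is a weak product, and $e\colon V\to Y$ is determined by projections and satisfies $g_1e=wq_1$, $g_2e=q_2$. A weak simple product of $g_1,g_2$ is such a $D$ with the property that for every other such $D'=(W',w',V',q_1',q_2',e')$ there are $h\colon W'\to W$ and $k\colon V'\to V$ with $wh=w'$, $q_1k=hq_1'$, $q_2k=q_2'$, $ek=e'$. $\mathbb{C}$ has weak simple products if every span $Z\leftarrow Y\to X$ in $\mathbb{C}$ has a weak simple product. *)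

(* Defs.v *)
From Stdlib Require Import FinFun.

Set Implicit Arguments.
Unset Strict Implicit.
Unset Printing Implicit Defensive.

Record category : Type := Category {
  ob :> Type;
  hom : ob -> ob -> Type;
  idm : forall X : ob, hom X X;
  comp : forall X Y Z : ob, hom Y Z -> hom X Y -> hom X Z;
  comp_idl : forall (X Y : ob) (f : hom X Y), comp (idm Y) f = f;
  comp_idr : forall (X Y : ob) (f : hom X Y), comp f (idm X) = f;
  comp_assoc : forall (X Y Z T : ob) (h : hom Z T) (g : hom Y Z) (f : hom X Y),
    comp h (comp g f) = comp (comp h g) f
}.

Arguments hom {c} X Y.
Arguments idm {c} X.
Arguments comp {c X Y Z} g f.

Declare Scope cat_scope.
Delimit Scope cat_scope with cat.
Notation "X ~> Y" := (hom X Y) (at level 90, Y at next level) : cat_scope.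
Notation "g ∘ f" := (comp g f) (at level 40, left associativity) : cat_scope.
Open Scope cat_scope.

Definition full_subcategory (E : category) (S : E -> Prop) : category :=
  @Category {X : E | S X}
    (fun X Y => proj1_sig X ~> proj1_sig Y)
    (fun X => idm (proj1_sig X))
    (fun _ _ _ g f => g ∘ f)
    (fun _ _ f => comp_idl f)
    (fun _ _ f => comp_idr f)
    (fun _ _ _ _ h g f => comp_assoc h g f).

(** ** Finite limits *)

Record functor (J E : category) : Type := Functor {
  fob :> J -> E;
  fmap : forall i j : J, (i ~> j) -> (fob i ~> fob j);
  fmap_id : forall i : J, fmap (idm i) = idm (fob i);
  fmap_comp : forall (i j k : J) (b : j ~> k) (a : i ~> j),
    fmap (b ∘ a) = fmap b ∘ fmap a
}.

Definition is_cone (J E : category) (D : functor J E) (L : E)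
    (p : forall i : J, L ~> D i) : Prop :=
  forall (i j : J) (a : i ~> j), fmap D a ∘ p i = p j.

Definition is_limit (J E : category) (D : functor J E) (L : E)
    (p : forall i : J, L ~> D i) : Prop :=
  is_cone p /\
  forall (T : E) (t : forall i : J, T ~> D i), is_cone t ->
    exists! u : T ~> L, forall i : J, p i ∘ u = t i.

Definition is_finite_category (J : category) : Prop :=
  Finite J /\ forall i j : J, Finite (i ~> j).

Definition has_finite_limits (E : category) : Prop :=
  forall (J : category), is_finite_category J ->
  forall (D : functor J E), exists (L : E) (p : forall i : J, L ~> D i), is_limit p.

Section Notions.

Context {E : category}.
Implicit Types A B C P Q R T X Y : E.

Definition is_terminal X : Prop := forall T, exists! u : T ~> X, True.

Definition is_product A B P (p1 : P ~> A) (p2 : P ~> B) : Prop :=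
  forall T (a : T ~> A) (b : T ~> B), exists! u : T ~> P, p1 ∘ u = a /\ p2 ∘ u = b.

Definition is_weak_product A B P (p1 : P ~> A) (p2 : P ~> B) : Prop :=
  forall T (a : T ~> A) (b : T ~> B), exists u : T ~> P, p1 ∘ u = a /\ p2 ∘ u = b.

Definition is_pullback A B C P (f : A ~> C) (g : B ~> C)
    (p1 : P ~> A) (p2 : P ~> B) : Prop :=
  f ∘ p1 = g ∘ p2 /\
  forall T (a : T ~> A) (b : T ~> B), f ∘ a = g ∘ b ->
    exists! u : T ~> P, p1 ∘ u = a /\ p2 ∘ u = b.

Definition is_kernel_pair X Q R (q : X ~> Q) (r1 r2 : R ~> X) : Prop :=
  is_pullback q q r1 r2.

Definition is_mono A B (m : A ~> B) : Prop :=
  forall T (h k : T ~> A), m ∘ h = m ∘ k -> h = k.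

Definition is_coequaliser R X Q (r1 r2 : R ~> X) (q : X ~> Q) : Prop :=
  q ∘ r1 = q ∘ r2 /\
  forall T (f : X ~> T), f ∘ r1 = f ∘ r2 -> exists! u : Q ~> T, u ∘ q = f.

Definition is_regular_epi A B (f : A ~> B) : Prop :=
  exists R (r1 r2 : R ~> A), is_coequaliser r1 r2 f.

(** ** Exact categories *)

Definition is_relation R X (r1 r2 : R ~> X) : Prop :=
  exists XX (p1 p2 : XX ~> X) (m : R ~> XX),
    is_product p1 p2 /\ is_mono m /\ p1 ∘ m = r1 /\ p2 ∘ m = r2.

Definition is_equivalence_relation R X (r1 r2 : R ~> X) : Prop :=
  is_relation r1 r2 /\
  (exists d : X ~> R, r1 ∘ d = idm X /\ r2 ∘ d = idm X) /\
  (exists s : R ~> R, r1 ∘ s = r2 /\ r2 ∘ s = r1) /\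
  (forall P (p1 p2 : P ~> R), is_pullback r2 r1 p1 p2 ->
     exists t : P ~> R, r1 ∘ t = r1 ∘ p1 /\ r2 ∘ t = r2 ∘ p2).

(** ** Projectivity *)

Definition is_projective P : Prop :=
  forall A B (r : A ~> B), is_regular_epi r ->
  forall f : P ~> B, exists f' : P ~> A, r ∘ f' = f.

(* Products are not chosen: [c1, c2] is any product [C × P], [t1, t2] is a
   product [T × P], and [tP] is the arrow [t × id_P] between them. *)
Definition is_internally_projective P : Prop :=
  forall C A B (r : A ~> B), is_regular_epi r ->
  forall CP (c1 : CP ~> C) (c2 : CP ~> P), is_product c1 c2 ->
  forall f : CP ~> B,
  exists T (t : T ~> C), is_regular_epi t /\
  exists TP (t1 : TP ~> T) (t2 : TP ~> P), is_product t1 t2 /\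
  exists tP : TP ~> CP, c1 ∘ tP = t ∘ t1 /\ c2 ∘ tP = t2 /\
  exists f' : TP ~> A, r ∘ f' = f ∘ tP.

(** ** Cartesian closure *)

(* [ev] exhibits [X] as [B ^ A]; [p1, p2] is a product [X × A], [q1, q2] ranges
   over all products [T × A], and [m] is the arrow [g × id_A]. *)
Definition is_exponential A B X P (p1 : P ~> X) (p2 : P ~> A) (ev : P ~> B) : Prop :=
  is_product p1 p2 /\
  forall T Q (q1 : Q ~> T) (q2 : Q ~> A), is_product q1 q2 ->
  forall f : Q ~> B, exists! g : T ~> X,
    forall m : Q ~> P, p1 ∘ m = g ∘ q1 -> p2 ∘ m = q2 -> ev ∘ m = f.

(** ** Weak simple products *)

Definition determined_by_projections Z X V Y
    (p1 : V ~> Z) (p2 : V ~> X) (f : V ~> Y) : Prop :=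
  forall T (h k : T ~> V), p1 ∘ h = p1 ∘ k -> p2 ∘ h = p2 ∘ k -> f ∘ h = f ∘ k.

Record wsp_data X Y Z (g1 : Y ~> Z) (g2 : Y ~> X) : Type := WspData {
  wsp_W : E;
  wsp_w : wsp_W ~> Z;
  wsp_V : E;
  wsp_q1 : wsp_V ~> wsp_W;
  wsp_q2 : wsp_V ~> X;
  wsp_e : wsp_V ~> Y;
  wsp_weak_product : is_weak_product wsp_q1 wsp_q2;
  wsp_determined : determined_by_projections wsp_q1 wsp_q2 wsp_e;
  wsp_comm1 : g1 ∘ wsp_e = wsp_w ∘ wsp_q1;
  wsp_comm2 : g2 ∘ wsp_e = wsp_q2
}.

Definition is_weak_simple_product X Y Z (g1 : Y ~> Z) (g2 : Y ~> X)
    (D : wsp_data g1 g2) : Prop :=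
  forall D' : wsp_data g1 g2,
  exists (h : wsp_W D' ~> wsp_W D) (k : wsp_V D' ~> wsp_V D),
    wsp_w D ∘ h = wsp_w D' /\
    wsp_q1 D ∘ k = h ∘ wsp_q1 D' /\
    wsp_q2 D ∘ k = wsp_q2 D' /\
    wsp_e D ∘ k = wsp_e D'.

End Notions.

Definition is_exact (E : category) : Prop :=
  has_finite_limits E /\
  (forall (A B C P : E) (f : A ~> C) (g : B ~> C) (p1 : P ~> A) (p2 : P ~> B),
     is_pullback f g p1 p2 -> is_regular_epi f -> is_regular_epi p2) /\
  (forall (R X : E) (r1 r2 : R ~> X), is_equivalence_relation r1 r2 ->
     exists (Q : E) (q : X ~> Q), is_coequaliser r1 r2 q /\ is_kernel_pair q r1 r2).

Definition is_projective_cover (E : category) (S : E -> Prop) : Prop :=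
  (forall X : E, S X -> is_projective X) /\
  (forall A : E, exists X : E, S X /\ exists q : X ~> A, is_regular_epi q).

Definition has_binary_products (E : category) : Prop :=
  forall A B : E, exists (P : E) (p1 : P ~> A) (p2 : P ~> B), is_product p1 p2.

Definition is_cartesian_closed (E : category) : Prop :=
  (exists X : E, is_terminal X) /\
  has_binary_products E /\
  (forall A B : E, exists (X P : E) (p1 : P ~> X) (p2 : P ~> A) (ev : P ~> B),
     is_exponential p1 p2 ev).

Definition has_weak_simple_products (C : category) : Prop :=
  forall (X Y Z : C) (g1 : Y ~> Z) (g2 : Y ~> X),
  exists D : wsp_data g1 g2, is_weak_simple_product D.

Definition weak_products_have_determined_idempotents (C : category) : Prop :=
  forall (Z X V : C) (p1 : V ~> Z) (p2 : V ~> X), is_weak_product p1 p2 ->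
  exists i : V ~> V,
    i ∘ i = i /\ determined_by_projections p1 p2 i /\ p1 ∘ i = p1 /\ p2 ∘ i = p2.

(* Main.v *)
From Stdlib Require Import List ClassicalEpsilon.
Require Import Defs.

(** Each of the three hypotheses makes the product in E of two objects of C
projective, because a cover of it splits.

If E is cartesian closed, the object of pairs (z, a section of Y -> Z × X over
{z} × X) exists in E; covering it by an object W of C, and W × X by an object V,
gives a weak simple product. An arrow out of a weak product that is determined
by projections is the same as an arrow out of the product in E, whence weak
universality.

Conversely, weak simple products weakly classify such sections, since arrows
from the projective T × X lift along covers. Taking Z terminal one weakly
classifies the arrows X -> B, for a cover X -> A, and taking sections of
equalisers one obtains weak universal quantifiers. With a quantifier over the
kernel pair of X -> A one cuts down to the arrows X -> B factoring through A,
obtaining W weakly classifying the arrows A -> B; with a quantifier over A one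
represents the pseudo-equivalence relation "w and w' name the same arrow" on W,
and its quotient is B ^ A. *)

Set Implicit Arguments.
Unset Strict Implicit.
Unset Printing Implicit Defensive.

(** * Finite limits *)

Definition empty_category : category :=
  @Category Empty_set (fun _ _ => Empty_set) (fun i => i) (fun _ _ _ _ f => f)
    (fun i => match i with end) (fun i => match i with end) (fun i => match i with end).

Lemma finite_limits_terminal (E : category) :
  has_finite_limits E -> exists X : E, is_terminal X.
Proof.
  intros hE.
  destruct (hE empty_category) with
    (D := @Functor empty_category E (fun i => match i with end)
            (fun i => match i with end) (fun i => match i with end)
            (fun i => match i with end)) as [L [p [_ Hp]]].
  - split; [exists nil; intros []|intros []].
  - exists L. intros T.
    destruct (Hp T (fun i => match i with end)) as [u [_ Hu]].
    + intros [].
    + exists u. split; [exact I|]. intros v _. apply Hu. intros [].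
Qed.

Definition discrete_bool : category.
Proof.
  refine (@Category bool (fun i j => i = j) (fun i => eq_refl)
    (fun _ _ _ g f => eq_trans f g) _ _ _).
  - intros X Y f; destruct f; reflexivity.
  - intros X Y f; destruct f; reflexivity.
  - intros X Y Z T h g f; destruct h, g, f; reflexivity.
Defined.

Definition pair_functor (E : category) (A B : E) : functor discrete_bool E.
Proof.
  refine (@Functor discrete_bool E (fun i : bool => if i then A else B)
    (fun i j (a : i = j) =>
       match a in _ = k return (if i then A else B) ~> (if k then A else B) with
       | eq_refl => idm _ end) _ _).
  - reflexivity.
  - intros i j k b a; destruct b, a; simpl. now rewrite comp_idl.
Defined.

Lemma finite_limits_products (E : category) :
  has_finite_limits E -> has_binary_products E.
Proof.
  intros hE A B.
  destruct (hE discrete_bool) with (D := pair_functor A B) as [L [p [_ Hp]]].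
  - split.
    + exists (true :: false :: nil). intros []; simpl; tauto.
    + intros i j. destruct (Bool.bool_dec i j) as [e|n].
      * exists (e :: nil). intros e'. left. apply Eqdep_dec.UIP_dec, Bool.bool_dec.
      * exists nil. intros e. contradiction.
  - exists L, (p true), (p false). intros T a b.
    destruct (Hp T (fun i : bool => if i return (T ~> if i then A else B)
                                    then a else b)) as [u [Hu Hu']].
    + intros i j e; destruct e; simpl. apply comp_idl.
    + exists u. split; [split; [apply (Hu true)|apply (Hu false)]|].
      intros v [Hv1 Hv2]. apply Hu'. intros []; assumption.
Qed.

Definition parallel_hom (i j : bool) : Type :=
  if i then (if j then unit else bool) else (if j then Empty_set else unit).

(** One of two composable arrows is always an identity, so the composite is the other one. *)
Definition parallel_comp (i j k : bool) :
    parallel_hom j k -> parallel_hom i j -> parallel_hom i k :=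
  match i, j, k return parallel_hom j k -> parallel_hom i j -> parallel_hom i k with
  | true, true, _ => fun b _ => b
  | true, false, true => fun b _ => match b with end
  | true, false, false => fun _ a => a
  | false, true, _ => fun _ a => match a with end
  | false, false, _ => fun b _ => b
  end.

(* [true] is the source and [false] the target of the two nonidentity arrows. *)
Definition parallel_pair : category.
Proof.
  refine (@Category bool parallel_hom
    (fun i => if i return parallel_hom i i then tt else tt) parallel_comp _ _ _).
  - intros [] []; simpl; intros []; reflexivity.
  - intros [] []; simpl; intros []; reflexivity.
  - intros [] [] [] []; simpl; intros [] [] []; reflexivity.
Defined.

Definition parallel_functor (E : category) (A B : E) (u v : A ~> B) :
  functor parallel_pair E.
Proof.
  refine (@Functor parallel_pair E (fun i : bool => if i then A else B)
    (fun i j : bool =>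
       match i, j return parallel_hom i j -> (if i then A else B) ~> (if j then A else B) with
       | true, true => fun _ => idm A
       | true, false => fun b : bool => if b then u else v
       | false, true => fun b => match b with end
       | false, false => fun _ => idm B
       end) _ _).
  - intros []; reflexivity.
  - intros [] [] []; simpl; intros [] []; simpl;
      rewrite ?comp_idl, ?comp_idr; reflexivity.
Defined.

Lemma finite_limits_equalisers (E : category) : has_finite_limits E ->
  forall (A B : E) (u v : A ~> B), exists (M : E) (i : M ~> A), u ∘ i = v ∘ i /\
    forall T (a : T ~> A), u ∘ a = v ∘ a -> exists! l : T ~> M, i ∘ l = a.
Proof.
  intros hE A B u v.
  destruct (hE parallel_pair) with (D := parallel_functor u v) as [L [p [Hc Hp]]].
  - split.
    + exists (true :: false :: nil). intros []; simpl; tauto.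
    + intros [] []; simpl.
      * exists (tt :: nil). intros []; simpl; tauto.
      * exists (true :: false :: nil). intros []; simpl; tauto.
      * exists nil. intros [].
      * exists (tt :: nil). intros []; simpl; tauto.
  - pose proof (Hc true false true) as H1. pose proof (Hc true false false) as H2.
    simpl in H1, H2.
    exists L, (p true). split; [congruence|]. intros T a Ha.
    destruct (Hp T (fun i : bool => if i return (T ~> if i then A else B)
                                    then a else u ∘ a)) as [l [Hl Hl']].
    + intros [] []; simpl; intros []; rewrite ?comp_idl; congruence.
    + exists l. split; [apply (Hl true)|].
      intros l' Hl1. apply Hl'. intros []; [exact Hl1|].
      simpl. rewrite <- H1, <- comp_assoc. f_equal. exact Hl1.
Qed.

(** * Chosen binary products *)

Class products (E : category) : Type := Products {
  prd : E -> E -> E;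
  pr1 : forall A B : E, prd A B ~> A;
  pr2 : forall A B : E, prd A B ~> B;
  pair : forall T A B : E, (T ~> A) -> (T ~> B) -> (T ~> prd A B);
  pr1_pair : forall (T A B : E) (a : T ~> A) (b : T ~> B), pr1 A B ∘ pair a b = a;
  pr2_pair : forall (T A B : E) (a : T ~> A) (b : T ~> B), pr2 A B ∘ pair a b = b;
  prd_ext : forall (T A B : E) (h k : T ~> prd A B),
    pr1 A B ∘ h = pr1 A B ∘ k -> pr2 A B ∘ h = pr2 A B ∘ k -> h = k
}.

Arguments pr1 {E _ A B}.
Arguments pr2 {E _ A B}.
Notation "A × B" := (prd A B) (at level 40, left associativity) : cat_scope.
Notation "⟨ f , g ⟩" := (pair f g) : cat_scope.

Lemma choose_products (E : category) : has_binary_products E -> inhabited (products E).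
Proof.
  intros h.
  assert (D : forall A B : E, {P : E & {p1 : P ~> A & {p2 : P ~> B | is_product p1 p2}}}).
  { intros A B.
    destruct (constructive_indefinite_description _ (h A B)) as [P H1].
    destruct (constructive_indefinite_description _ H1) as [p1 H2].
    destruct (constructive_indefinite_description _ H2) as [p2 H3].
    exists P, p1, p2. exact H3. }
  assert (U : forall (A B T : E) (a : T ~> A) (b : T ~> B),
    {u : T ~> projT1 (D A B) |
      projT1 (projT2 (D A B)) ∘ u = a /\ proj1_sig (projT2 (projT2 (D A B))) ∘ u = b}).
  { intros A B T a b. apply constructive_indefinite_description.
    destruct (D A B) as [P [p1 [p2 H]]]; simpl.
    destruct (H T a b) as [u [Hu _]]. now exists u. }
  constructor.
  refine (@Products E (fun A B => projT1 (D A B)) (fun A B => projT1 (projT2 (D A B)))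
    (fun A B => proj1_sig (projT2 (projT2 (D A B))))
    (fun T A B a b => proj1_sig (U A B T a b)) _ _ _).
  - intros T A B a b. apply (proj2_sig (U A B T a b)).
  - intros T A B a b. apply (proj2_sig (U A B T a b)).
  - intros T A B. destruct (D A B) as [P [p1 [p2 H]]]; simpl. intros f g H1 H2.
    destruct (H T (p1 ∘ g) (p2 ∘ g)) as [u [_ Hu]].
    rewrite <- (Hu f), <- (Hu g); auto.
Qed.

Section Products.

Context {E : category} {PR : products E}.
Implicit Types A B C T X : E.

Lemma pair_comp T U A B (a : T ~> A) (b : T ~> B) (f : U ~> T) :
  ⟨a, b⟩ ∘ f = ⟨a ∘ f, b ∘ f⟩.
Proof. apply prd_ext; rewrite comp_assoc; [rewrite !pr1_pair|rewrite !pr2_pair]; reflexivity. Qed.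

Lemma pair_eta T A B (f : T ~> A × B) : ⟨pr1 ∘ f, pr2 ∘ f⟩ = f.
Proof. apply prd_ext; rewrite ?pr1_pair, ?pr2_pair; reflexivity. Qed.

Lemma pair_pr A B : ⟨pr1, pr2⟩ = idm (A × B).
Proof. apply prd_ext; rewrite ?pr1_pair, ?pr2_pair, comp_idr; reflexivity. Qed.

Lemma prd_is_product A B : is_product (@pr1 E PR A B) pr2.
Proof.
  intros T a b. exists ⟨a, b⟩. split; [now rewrite pr1_pair, pr2_pair|].
  intros u [<- <-]. apply pair_eta.
Qed.

End Products.

Arguments prd_is_product {E PR} A B.

#[export] Hint Rewrite @pair_comp @pr1_pair @pr2_pair @comp_idl @comp_idr @pair_eta @pair_pr : cat.
#[export] Hint Rewrite <- @comp_assoc : cat.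

Ltac cat := autorewrite with cat.
Tactic Notation "cat" "in" hyp(H) := autorewrite with cat in H.

Notation "f ×id" := (⟨f ∘ pr1, pr2⟩) (at level 30) : cat_scope.

(* Stated for composites associated to the right, the normal form of [cat]. *)
Lemma comp_eq_whisker (E : category) (T X Y Y' Z : E) (g : Y ~> Z) (f : X ~> Y)
    (g' : Y' ~> Z) (f' : X ~> Y') (a : T ~> X) :
  g ∘ f = g' ∘ f' -> g ∘ (f ∘ a) = g' ∘ (f' ∘ a).
Proof. intros H. now rewrite !comp_assoc, H. Qed.

Section Limits.

Context {E : category} {PR : products E} (hE : has_finite_limits E).

Lemma finite_limits_pullbacks (A B C : E) (f : A ~> C) (g : B ~> C) :
  exists (P : E) (p1 : P ~> A) (p2 : P ~> B), is_pullback f g p1 p2.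
Proof.
  destruct (finite_limits_equalisers hE (f ∘ pr1) (g ∘ pr2)) as [P [i [Hi Hu]]].
  exists P, (pr1 ∘ i), (pr2 ∘ i). split; [now rewrite !comp_assoc|].
  intros T a b Hab. destruct (Hu T ⟨a, b⟩) as [u [Hu1 Hu2]].
  - now cat.
  - exists u. split.
    + rewrite <- !comp_assoc, Hu1. now cat.
    + intros v [<- <-]. apply Hu2. apply prd_ext; now cat.
Qed.

End Limits.

(** * Regular epimorphisms and projective covers *)

Lemma regular_epi_epi (E : category) (X Q T : E) (q : X ~> Q) (h k : Q ~> T) :
  is_regular_epi q -> h ∘ q = k ∘ q -> h = k.
Proof.
  intros [R [r1 [r2 [Hq Hu]]]] H. destruct (Hu T (k ∘ q)) as [u [_ Hu']].
  - rewrite <- !comp_assoc. now f_equal.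
  - rewrite <- (Hu' h H). now apply Hu'.
Qed.

Lemma section_projective (E : category) (P Q : E) (r : P ~> Q) (s : Q ~> P) :
  r ∘ s = idm Q -> is_projective P -> is_projective Q.
Proof.
  intros Hrs hP A B g Hg f. destruct (hP _ _ g Hg (f ∘ r)) as [f' Hf'].
  exists (f' ∘ s). rewrite comp_assoc, Hf', <- comp_assoc, Hrs. apply comp_idr.
Qed.

Section Exact.

Context {E : category} {PR : products E} (hE : is_exact E).
Context {S : E -> Prop} (hS : is_projective_cover S).

Lemma cover (A : E) : exists (X : E) (q : X ~> A), S X /\ is_regular_epi q.
Proof. destruct hS as [_ H]. destruct (H A) as [X [HX [q Hq]]]. now exists X, q. Qed.

Lemma cover_lift (T A B : E) (r : A ~> B) (f : T ~> B) :
  S T -> is_regular_epi r -> exists f' : T ~> A, r ∘ f' = f.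
Proof. intros HT Hr. destruct hS as [H _]. exact (H T HT A B r Hr f). Qed.

(** Equality can be tested on elements whose shape lies in [S]: a cover of [A] is such an element
    and is epi. *)
Lemma cover_ext (A B : E) (f g : A ~> B) :
  (forall T (a : T ~> A), S T -> f ∘ a = g ∘ a) -> f = g.
Proof.
  intros H. destruct (cover A) as [X [q [HX Hq]]].
  apply (regular_epi_epi Hq). now apply H.
Qed.

(** On elements with domain in [S], the two arrows coequalised by [q] become a pair that [q]
    identifies, so [f] coequalises them too. *)
Lemma regular_epi_descends (X Q B : E) (q : X ~> Q) (f : X ~> B) :
  is_regular_epi q ->
  (forall T (a b : T ~> X), S T -> q ∘ a = q ∘ b -> f ∘ a = f ∘ b) ->
  exists u : Q ~> B, u ∘ q = f.
Proof.
  intros [R [r1 [r2 [Hq Hu]]]] H. destruct (Hu B f) as [u [Hu1 _]].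
  - apply cover_ext. intros T a HT. rewrite <- !comp_assoc. apply H; [exact HT|].
    now rewrite !comp_assoc, Hq.
  - now exists u.
Qed.

(** A diagonal filler: [y] is constant on the fibres of [c] since [m] is monic. *)
Lemma regular_epi_orthogonal_mono (A P R Z : E) (c : A ~> P) (m : R ~> Z)
    (x : P ~> Z) (y : A ~> R) :
  is_regular_epi c -> is_mono m -> m ∘ y = x ∘ c -> exists u : P ~> R, m ∘ u = x.
Proof.
  intros Hc Hm Hy. destruct (@regular_epi_descends _ _ _ c y Hc) as [u Hu].
  - intros T a b _ Hab. apply Hm. rewrite !comp_assoc, Hy, <- !comp_assoc. now f_equal.
  - exists u. apply (regular_epi_epi Hc). now rewrite <- comp_assoc, Hu.
Qed.

(** [q ×id] is the pullback of [q] along the projection [A × W ~> A]. *)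
Lemma regular_epi_timesl (X A W : E) (q : X ~> A) :
  is_regular_epi q -> is_regular_epi (q ×id : X × W ~> A × W).
Proof.
  intros Hq. destruct hE as [_ [Hst _]].
  refine (Hst _ _ _ _ q pr1 pr1 (q ×id) _ Hq). split; [now cat|].
  intros T a b Hab. exists ⟨a, pr2 ∘ b⟩. split.
  - split; cat; [reflexivity|]. rewrite Hab. now cat.
  - intros v [<- <-]. now cat.
Qed.

Lemma regular_epi_timesr (X A W : E) (q : X ~> A) :
  is_regular_epi q -> is_regular_epi (⟨pr1, q ∘ pr2⟩ : W × X ~> W × A).
Proof.
  intros Hq. destruct hE as [_ [Hst _]].
  refine (Hst _ _ _ _ q pr2 pr2 ⟨pr1, q ∘ pr2⟩ _ Hq). split; [now cat|].
  intros T a b Hab. exists ⟨pr1 ∘ b, a⟩. split.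
  - split; cat; [reflexivity|]. rewrite Hab. now cat.
  - intros v [<- <-]. now cat.
Qed.

(** The image is the quotient of [A] by the kernel pair of [f]. *)
Lemma image_factorisation (A Z : E) (f : A ~> Z) :
  exists (R : E) (e : A ~> R) (m : R ~> Z), is_regular_epi e /\ is_mono m /\ m ∘ e = f.
Proof.
  destruct (finite_limits_pullbacks (proj1 hE) f f) as [K [k1 [k2 [Hk Hu]]]].
  destruct (proj2 (proj2 hE) K A k1 k2) as [R [e [He [Hc He']]]].
  { split; [|split; [|split]].
    - exists (A × A), pr1, pr2, ⟨k1, k2⟩.
      split; [apply prd_is_product|split; [|now cat]].
      intros T a b Hab.
      pose proof (f_equal (fun x => pr1 ∘ x) Hab) as H1.
      pose proof (f_equal (fun x => pr2 ∘ x) Hab) as H2.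
      simpl in H1, H2. autorewrite with cat in H1, H2.
      destruct (Hu T (k1 ∘ b) (k2 ∘ b)) as [u [_ Hu']].
      + now rewrite !comp_assoc, Hk.
      + rewrite <- (Hu' a), <- (Hu' b); auto.
    - destruct (Hu A (idm A) (idm A) eq_refl) as [d [Hd _]]. now exists d.
    - destruct (Hu K k2 k1 (eq_sym Hk)) as [s [Hs _]]. now exists s.
    - intros P p1 p2 [Hp _]. destruct (Hu P (k1 ∘ p1) (k2 ∘ p2)) as [t [Ht _]].
      + rewrite (comp_eq_whisker _ Hk), Hp. now apply comp_eq_whisker.
      + now exists t. }
  assert (Re : is_regular_epi e) by now exists K, k1, k2.
  destruct He as [_ Hm]. destruct (Hm Z f Hk) as [m [Hm1 _]].
  exists R, e, m. split; [exact Re|split; [|exact Hm1]].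
  (* Elements of [R] identified by [m] lift along [e] to elements of [A] with equal values under
     [f], hence to one of the kernel pair, whose legs [e] identifies. *)
  intros T h k Hhk. apply cover_ext. intros T' c HT'.
  destruct (cover_lift (h ∘ c) HT' Re) as [h' Hh].
  destruct (cover_lift (k ∘ c) HT' Re) as [k' Hk'].
  destruct (Hu T' h' k') as [u [[<- <-] _]].
  - rewrite <- Hm1, <- !comp_assoc, Hh, Hk', !comp_assoc. now f_equal.
  - rewrite <- Hh, <- Hk', !comp_assoc. f_equal. apply Hc.
Qed.

(** The pair [r1], [r2] need not be jointly monic, but the image [R] of [⟨r1, r2⟩] is an equivalence
    relation. Arrows into [R] from objects of [S] lift to [R0], so on such objects [R0] describes
    the kernel pair of [q]. *)
Lemma pseudo_equivalence_quotient (W R0 : E) (r1 r2 : R0 ~> W) :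
  S W -> S R0 ->
  (exists d : W ~> R0, r1 ∘ d = idm W /\ r2 ∘ d = idm W) ->
  (exists s : R0 ~> R0, r1 ∘ s = r2 /\ r2 ∘ s = r1) ->
  (forall T (a b : T ~> R0), S T -> r2 ∘ a = r1 ∘ b ->
    exists t : T ~> R0, r1 ∘ t = r1 ∘ a /\ r2 ∘ t = r2 ∘ b) ->
  exists (Q : E) (q : W ~> Q), is_regular_epi q /\ forall T (a b : T ~> W), S T ->
    q ∘ a = q ∘ b <-> exists g : T ~> R0, r1 ∘ g = a /\ r2 ∘ g = b.
Proof.
  intros HW HR0 [d [Hd1 Hd2]] [s [Hs1 Hs2]] Ht.
  destruct (image_factorisation ⟨r1, r2⟩) as [R [e [m [He [Hm Hme]]]]].
  assert (H1 : pr1 ∘ m ∘ e = r1) by (rewrite <- comp_assoc, Hme; apply pr1_pair).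
  assert (H2 : pr2 ∘ m ∘ e = r2) by (rewrite <- comp_assoc, Hme; apply pr2_pair).
  destruct (proj2 (proj2 hE) R W (pr1 ∘ m) (pr2 ∘ m)) as [Q [q [Hq [Hc Hu]]]].
  { split; [|split; [|split]].
    - exists (W × W), pr1, pr2, m. split; [apply prd_is_product|auto].
    - exists (e ∘ d). now rewrite !comp_assoc, H1, H2.
    - destruct (@regular_epi_orthogonal_mono _ _ _ _ e m ⟨pr2 ∘ m, pr1 ∘ m⟩ (e ∘ s))
        as [u Hu]; auto.
      + apply prd_ext; rewrite !comp_assoc; [rewrite H1, Hs1|rewrite H2, Hs2];
          cat; rewrite comp_assoc; auto.
      + exists u. rewrite <- !comp_assoc, Hu. now cat.
    - intros P p1 p2 [Hp _]. destruct (cover P) as [T [c [HT Hc]]].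
      destruct (cover_lift (p1 ∘ c) HT He) as [a Ha].
      destruct (cover_lift (p2 ∘ c) HT He) as [b Hb].
      destruct (Ht T a b HT) as [t [Ht1 Ht2]].
      + rewrite <- H1, <- H2, <- comp_assoc, Ha, <- (comp_assoc _ e), Hb, !comp_assoc.
        now f_equal.
      + destruct (@regular_epi_orthogonal_mono _ _ _ _ c m
          ⟨pr1 ∘ m ∘ p1, pr2 ∘ m ∘ p2⟩ (e ∘ t)) as [u Hu]; auto.
        * apply prd_ext; rewrite !comp_assoc; [rewrite H1, Ht1, <- H1|rewrite H2, Ht2, <- H2];
            rewrite <- (comp_assoc _ e); [rewrite Ha|rewrite Hb]; now cat.
        * exists u. rewrite <- !comp_assoc, Hu. now cat. }
  exists Q, q. split; [now exists R, (pr1 ∘ m), (pr2 ∘ m)|].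
  intros T a b HT. split.
  - intros Hab. destruct (Hu T a b Hab) as [k [[<- <-] _]].
    destruct (cover_lift k HT He) as [g <-]. exists g.
    now rewrite (comp_assoc _ e), (comp_assoc _ e), H1, H2.
  - intros [g [<- <-]]. rewrite <- H1, <- H2, <- !(comp_assoc _ e).
    now apply comp_eq_whisker.
Qed.

(** * Weak products in a projective cover *)

Notation C := (full_subcategory S).

Lemma cover_weak_product (X Y V : C) (r : proj1_sig V ~> proj1_sig X × proj1_sig Y) :
  is_regular_epi r -> @is_weak_product C X Y V (pr1 ∘ r) (pr2 ∘ r).
Proof.
  intros Hr [T HT] a b. simpl in *.
  destruct (cover_lift ⟨a, b⟩ HT Hr) as [u Hu]. exists u.
  rewrite <- !comp_assoc, Hu. now cat.
Qed.

(* The arrow [r] need not be shown to be a regular epimorphism: it suffices that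
   any cover of [X × Y] factors through it. *)
Lemma weak_product_epi (X Y V : C) (q1 : V ~> X) (q2 : V ~> Y) (T : E)
    (f g : proj1_sig X × proj1_sig Y ~> T) (r := ⟨q1 : proj1_sig V ~> _, q2⟩) :
  is_weak_product q1 q2 -> f ∘ r = g ∘ r -> f = g.
Proof.
  intros Hw H. apply cover_ext. intros U a HU.
  destruct (Hw (exist S U HU) (pr1 ∘ a) (pr2 ∘ a)) as [u [H1 H2]]. simpl in *.
  assert (Ha : r ∘ u = a) by (unfold r; apply prd_ext; now cat).
  rewrite <- Ha, !comp_assoc. now f_equal.
Qed.

(** Any cover [c] of the product factors through [⟨q1, q2⟩] by some [u]. As [e] is determined by
    projections, [e ∘ u] is constant on the fibres of [c] and descends to the product. *)
Lemma determined_factors (X Y V M : C) (q1 : V ~> X) (q2 : V ~> Y) (e : V ~> M) :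
  is_weak_product q1 q2 -> determined_by_projections q1 q2 e ->
  exists f : proj1_sig X × proj1_sig Y ~> proj1_sig M,
    f ∘ ⟨q1 : proj1_sig V ~> _, q2⟩ = e.
Proof.
  destruct X as [X HX], Y as [Y HY], V as [V HV], M as [M HM].
  simpl in *. intros Hw He.
  destruct (cover (X × Y)) as [A [c [HA Hc]]].
  destruct (Hw (exist S A HA) (pr1 ∘ c) (pr2 ∘ c)) as [u [H1 H2]]. simpl in *.
  assert (Hu : ⟨q1, q2⟩ ∘ u = c) by (apply prd_ext; now cat).
  destruct (@regular_epi_descends _ _ _ c (e ∘ u) Hc) as [f Hf].
  - intros T a b HT Hab. rewrite <- !comp_assoc.
    apply (He (exist S T HT) (u ∘ a) (u ∘ b)); simpl;
      rewrite !comp_assoc, ?H1, ?H2, <- !comp_assoc; now f_equal.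
  (* [u ∘ v] need not be the identity of [V], but it has the same projections, which is all that [e]
     sees. *)
  - exists f. destruct (cover_lift ⟨q1, q2⟩ HV Hc) as [v Hv].
    rewrite <- Hv, comp_assoc, Hf, <- comp_assoc.
    transitivity (e ∘ idm V); [|apply comp_idr]. apply (He (exist S V HV) (u ∘ v) (idm V)); simpl;
      rewrite !comp_assoc, ?H1, ?H2, comp_idr, <- !comp_assoc, Hv; now cat.
Qed.

Lemma products_projective :
  (forall P : E, is_projective P -> is_internally_projective P)
    \/ has_binary_products (full_subcategory (@is_projective E))
    \/ weak_products_have_determined_idempotents C ->
  forall X Y : E, S X -> S Y -> is_projective (X × Y).
Proof.
  intros h X Y HX HY. destruct hS as [Hproj _].
  destruct (cover (X × Y)) as [A [r [HA Hr]]].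
  destruct h as [h|[h|h]].
  (* Internal projectivity of [Y], applied to the identity of [X × Y], lifts [t × id] along [r]; and
     [t] splits because [X] is projective. *)
  - destruct (h Y (Hproj Y HY) X A (X × Y) r Hr _ _ _ (prd_is_product X Y) (idm _))
      as [T [t [Ht [TP [t1 [t2 [HP [tP [H1 [H2 [f Hf]]]]]]]]]]].
    destruct (cover_lift (idm X) HX Ht) as [s Hs].
    destruct (HP (X × Y) (s ∘ pr1) pr2) as [u [[Hu1 Hu2] _]].
    apply (@section_projective _ _ _ r (f ∘ u)); [|now apply Hproj].
    rewrite comp_assoc, Hf, comp_idl.
    apply prd_ext; rewrite comp_assoc, ?H1, ?H2, comp_idr; [|exact Hu2].
    now rewrite <- comp_assoc, Hu1, comp_assoc, Hs, comp_idl.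
  (* Here [X × Y] is a retract of the product [P] formed among projectives: uniqueness of arrows
     into [P] makes [a] descend along [r]. *)
  - destruct (h (exist _ X (Hproj X HX)) (exist _ Y (Hproj Y HY)))
      as [[P HP] [p1 [p2 Hp]]]. simpl in *.
    destruct (Hp (exist _ A (Hproj A HA)) (pr1 ∘ r) (pr2 ∘ r)) as [a [[Ha1 Ha2] _]].
    simpl in *.
    destruct (@regular_epi_descends _ _ _ r a Hr) as [s Hs].
    + intros T x y HT Hxy.
      destruct (Hp (exist _ T (Hproj T HT)) (p1 ∘ (a ∘ x)) (p2 ∘ (a ∘ x))) as [u [_ Hu]].
      simpl in *. rewrite <- (Hu (a ∘ x)), <- (Hu (a ∘ y)); auto.
      rewrite !comp_assoc, Ha1, Ha2, <- !comp_assoc. now rewrite Hxy.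
    + apply (@section_projective _ _ _ ⟨p1, p2⟩ s); [|exact HP].
      apply (regular_epi_epi Hr). rewrite <- comp_assoc, Hs.
      apply prd_ext; now cat.
  (* The idempotent of the weak product [A] descends along [r] to a section of [r]. *)
  - destruct (h (exist S X HX) (exist S Y HY) (exist S A HA) (pr1 ∘ r) (pr2 ∘ r))
      as [i [_ [Hi [H1 H2]]]].
    + now apply cover_weak_product.
    + simpl in *. destruct (@regular_epi_descends _ _ _ r i Hr) as [s Hs].
      * intros T a b HT Hab. apply (Hi (exist S T HT)); simpl;
          rewrite <- !comp_assoc; now f_equal.
      * apply (@section_projective _ _ _ r s); [|now apply Hproj].
        apply (regular_epi_epi Hr). rewrite <- comp_assoc, Hs, comp_idl.
        apply prd_ext; rewrite comp_assoc; assumption.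
Qed.

(** * Exponentials from weak simple products *)

Section Exponentials.

Context (hproj : forall X Y : E, S X -> S Y -> is_projective (X × Y)).
Context (hwsp : has_weak_simple_products C).

(* In set-like terms, [W] weakly classifies the pairs of a point [z : Z] and a
   section over [{z} × X] of [(m1, m2) : M -> Z × X]. *)
Lemma weak_section_classifier (X Z M : E) (m1 : M ~> Z) (m2 : M ~> X) : S X ->
  exists (W : E) (w : W ~> Z) (e : W × X ~> M),
    S W /\ m1 ∘ e = w ∘ pr1 /\ m2 ∘ e = pr2 /\
    forall T (t : T ~> Z) (f : T × X ~> M), S T -> m1 ∘ f = t ∘ pr1 -> m2 ∘ f = pr2 ->
      exists h : T ~> W, w ∘ h = t /\ e ∘ (h ×id) = f.
Proof.
  (* Weak simple products are given for spans in [C] only: [Z] is covered by [Z0], [M] is pulled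
     back to [M'] over [Z0], and [M'] is covered by [Y]. *)
  intros HX. destruct (cover Z) as [Z0 [z [HZ Hz]]].
  destruct (finite_limits_pullbacks (proj1 hE) z m1) as [M' [m' [n [Hm' HM']]]].
  destruct (cover M') as [Y [c [HY Hc]]].
  destruct (hwsp (X := exist S X HX) (Y := exist S Y HY) (Z := exist S Z0 HZ)
    (m' ∘ c) (m2 ∘ n ∘ c)) as [D HD].
  destruct D as [W w V q1 q2 e Hw Hd Hc1 Hc2].
  destruct (determined_factors Hw Hd) as [ē He].
  pose proof (fun T f g => @weak_product_epi _ _ _ _ _ T f g Hw) as Depi.
  destruct W as [W HW], V as [V HV]; simpl in *.
  exists W, (z ∘ w), (n ∘ c ∘ ē). split; [exact HW|split; [|split]].
  - rewrite 2!comp_assoc, <- Hm', <- 3!comp_assoc. f_equal. apply Depi.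
    rewrite <- !comp_assoc, He, pr1_pair, comp_assoc. exact Hc1.
  - apply Depi. rewrite <- !comp_assoc, He, pr2_pair, !comp_assoc. exact Hc2.
  - intros T t f HT H1 H2.
    destruct (cover_lift t HT Hz) as [t0 Ht0].
    destruct (HM' (T × X) (t0 ∘ pr1) f) as [l [[Hl1 Hl2] _]].
    { now rewrite comp_assoc, Ht0, H1. }
    (* [T × X] need not lie in [S], but it is projective, so the section [l] lifts from [M'] to
       [Y]. *)
    destruct (hproj HT HX Hc l) as [f0 Hf0].
    (* A cover of [T × X] is a weak product in [C], and [f0 ∘ v] is determined by projections
       because it factors through [T × X]; this gives a competitor for [HD]. *)
    destruct (cover (T × X)) as [V' [v [HV' Hv]]].
    destruct (HD (@WspData C (exist S X HX) (exist S Y HY) (exist S Z0 HZ)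
      (m' ∘ c) (m2 ∘ n ∘ c) (exist S T HT) t0 (exist S V' HV') (pr1 ∘ v) (pr2 ∘ v)
      (f0 ∘ v) (@cover_weak_product (exist S T HT) (exist S X HX) (exist S V' HV') v Hv)
      ltac:(intros [U HU] a b; simpl; rewrite <- !comp_assoc; intros Ha Hb;
            f_equal; now apply prd_ext)
      ltac:(simpl; rewrite <- !comp_assoc, (comp_assoc c), Hf0, comp_assoc, Hl1;
            symmetry; apply comp_assoc)
      ltac:(simpl; rewrite <- !comp_assoc, (comp_assoc c), Hf0, (comp_assoc n), Hl2,
              comp_assoc, H2; reflexivity)))
      as [h [k [K1 [K2 [K3 K4]]]]]; simpl in *.
    exists h. split; [now rewrite <- comp_assoc, K1|].
    rewrite <- comp_assoc, <- Hl2, <- Hf0, (comp_assoc n). f_equal.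
    apply (regular_epi_epi Hv). rewrite <- K4, <- He, <- !comp_assoc. f_equal.
    apply prd_ext; cat; auto.
Qed.

(* [W] is a weak version of [{z : Z | forall x : X, u z x = v z x}]. *)
Lemma weak_universal_quantification (X Z B : E) (u v : Z × X ~> B) :
  exists (W : E) (w : W ~> Z), S W /\ u ∘ (w ×id) = v ∘ (w ×id) /\
    forall T (t : T ~> Z), S T -> u ∘ (t ×id) = v ∘ (t ×id) ->
      exists h : T ~> W, w ∘ h = t.
Proof.
  (* The classifier requires an object of [S], whence the cover [X0] of [X]. Over a point of [Z],
     the equaliser [M] has a section exactly when [u] and [v] agree there on [X0]. *)
  destruct (cover X) as [X0 [x [HX Hx]]].
  destruct (finite_limits_equalisers (proj1 hE) (u ∘ ⟨pr1, x ∘ pr2⟩) (v ∘ ⟨pr1, x ∘ pr2⟩))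
    as [M [i [Hi HM]]].
  destruct (@weak_section_classifier X0 Z M (pr1 ∘ i) (pr2 ∘ i) HX)
    as [W [w [e [HW [H1 [H2 Hu]]]]]].
  assert (Hie : i ∘ e = w ×id) by (apply prd_ext; rewrite comp_assoc, ?H1, ?H2; now cat).
  exists W, w. split; [exact HW|split].
  - apply (regular_epi_epi (regular_epi_timesr W Hx)).
    pose proof (comp_eq_whisker e Hi) as H. rewrite Hie in H. cat in H. now cat.
  - intros T t HT Ht. destruct (HM _ (t ×id : T × X0 ~> _)) as [f [Hf _]].
    + pose proof (comp_eq_whisker ⟨pr1, x ∘ pr2⟩ Ht) as H. cat in H. now cat.
    + destruct (Hu T t f HT) as [h [Hh _]]; [| |now exists h];
        rewrite <- comp_assoc, Hf; now cat.
Qed.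

Lemma weak_exponential (A B : E) :
  exists (W : E) (ev : W × A ~> B), S W /\
    forall T (f : T × A ~> B), S T -> exists h : T ~> W, ev ∘ (h ×id) = f.
Proof.
  destruct (cover A) as [X [x [HX Hx]]].
  destruct (finite_limits_terminal (proj1 hE)) as [I HI].
  destruct (HI (X × B)) as [bang _].
  (* Over the terminal object, the sections of [X × B] are the graphs of arrows [X ~> B]. *)
  destruct (@weak_section_classifier X I (X × B) bang pr1 HX)
    as [W0 [w0 [e [HW0 [_ [He Hu]]]]]].
  destruct (finite_limits_pullbacks (proj1 hE) x x) as [K [d0 [d1 [Hd HK]]]].
  (* The names of arrows that agree on both legs of the kernel pair of [x], and so descend to
     [A]. *)
  destruct (@weak_universal_quantification K W0 B
    (pr2 ∘ e ∘ ⟨pr1, d0 ∘ pr2⟩) (pr2 ∘ e ∘ ⟨pr1, d1 ∘ pr2⟩)) as [W [w [HW [Hw Hw']]]].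
  destruct (@regular_epi_descends _ _ _ _ (pr2 ∘ e ∘ (w ×id)) (regular_epi_timesr W Hx))
    as [ev Hev].
  { intros T a b HT Hab.
    pose proof (f_equal (fun y => pr1 ∘ y) Hab) as H1.
    pose proof (f_equal (fun y => pr2 ∘ y) Hab) as H2.
    simpl in H1, H2. cat in H1. cat in H2.
    destruct (HK T (pr2 ∘ a) (pr2 ∘ b) H2) as [k [[Hk1 Hk2] _]].
    pose proof (comp_eq_whisker ⟨pr1 ∘ a, k⟩ Hw) as H. cat in H.
    cat. rewrite <- Hk1, <- Hk2, H, H1. reflexivity. }
  exists W, ev. split; [exact HW|]. intros T f HT.
  destruct (HI T) as [t _].
  destruct (Hu T t ⟨pr2, f ∘ ⟨pr1, x ∘ pr2⟩⟩ HT) as [h0 [_ Hh0]].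
  { destruct (HI (T × X)) as [y [_ Hy]]. now rewrite <- (Hy (bang ∘ _)), <- (Hy (t ∘ _)). }
  { now cat. }
  assert (H0 : pr2 ∘ e ∘ (h0 ×id) = f ∘ ⟨pr1, x ∘ pr2⟩)
    by (rewrite <- comp_assoc, Hh0; now cat).
  destruct (Hw' T h0 HT) as [h Hh].
  - pose proof (comp_eq_whisker ⟨pr1, d0 ∘ pr2⟩ H0) as H1.
    pose proof (comp_eq_whisker ⟨pr1, d1 ∘ pr2⟩ H0) as H2.
    cat in H1. cat in H2.
    cat. rewrite H1, H2, !comp_assoc, Hd. reflexivity.
  - exists h. apply (regular_epi_epi (regular_epi_timesr T Hx)). rewrite <- H0, <- Hh.
    pose proof (comp_eq_whisker (h ×id) Hev) as H. cat in H. now cat.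
Qed.

Lemma exponential (A B : E) :
  exists (Q : E) (ev : Q × A ~> B), forall T (f : T × A ~> B),
    exists! g : T ~> Q, ev ∘ (g ×id) = f.
Proof.
  destruct (weak_exponential A B) as [W [ev [HW Hev]]].
  destruct (@weak_universal_quantification A (W × W) B (ev ∘ ⟨pr1 ∘ pr1, pr2⟩)
    (ev ∘ ⟨pr2 ∘ pr1, pr2⟩)) as [R [r [HR [Hr Hr']]]].
  cat in Hr.
  (* On objects of [S], [R] expresses an equality of named arrows; reflexivity, symmetry and
     transitivity are inherited from it. *)
  assert (HR' : forall T (a b : T ~> W), S T ->
    ev ∘ (a ×id) = ev ∘ (b ×id) <-> exists g : T ~> R, pr1 ∘ r ∘ g = a /\ pr2 ∘ r ∘ g = b).
  { intros T a b HT. split.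
    - intros H. destruct (Hr' T ⟨a, b⟩ HT) as [g Hg]; [now cat|].
      exists g. rewrite <- !comp_assoc, Hg. now cat.
    - intros [g [<- <-]]. pose proof (f_equal (fun y => y ∘ (g ×id)) Hr) as H.
      simpl in H. cat in H. now cat. }
  destruct (@pseudo_equivalence_quotient W R (pr1 ∘ r) (pr2 ∘ r) HW HR)
    as [Q [q [Hq HQ]]].
  { now apply HR'. }
  { destruct (proj1 (HR' R (pr2 ∘ r) (pr1 ∘ r) HR)) as [s Hs]; [|now exists s].
    cat. symmetry. exact Hr. }
  { intros T a b HT Hab. apply HR'; [exact HT|].
    transitivity (ev ∘ ((pr2 ∘ r ∘ a) ×id)); [|rewrite Hab];
      apply HR'; eauto. }
  assert (HQ' : forall T (a b : T ~> W), S T ->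
    q ∘ a = q ∘ b <-> ev ∘ (a ×id) = ev ∘ (b ×id)).
  { intros T a b HT. rewrite HR' by exact HT. now apply HQ. }
  (* Two names of the same class evaluate alike at every point of [A], so evaluation descends to
     [Q]. *)
  destruct (@regular_epi_descends _ _ _ _ ev (regular_epi_timesl A Hq)) as [ev' Hev'].
  { intros T a b HT Hab.
    pose proof (f_equal (fun y => pr1 ∘ y) Hab) as H1.
    pose proof (f_equal (fun y => pr2 ∘ y) Hab) as H2.
    simpl in H1, H2. cat in H1. cat in H2.
    apply HQ' in H1; [|exact HT].
    pose proof (f_equal (fun y => y ∘ ⟨idm T, pr2 ∘ a⟩) H1) as H. simpl in H. cat in H.
    rewrite H2 in H. cat in H. exact H. }
  exists Q, ev'. intros T f.
  (* For arbitrary [T], a name [g] is available only over a cover [P]. Names of one arrow have the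
     same class, so [q ∘ g] descends to [T]. *)
  destruct (cover T) as [P [c [HP Hc]]].
  destruct (Hev P (f ∘ (c ×id)) HP) as [g Hg].
  destruct (@regular_epi_descends _ _ _ c (q ∘ g) Hc) as [g' Hg'].
  { intros U a b HU Hab. rewrite <- !comp_assoc. apply HQ'; [exact HU|].
    pose proof (comp_eq_whisker (a ×id) Hg) as Ha. pose proof (comp_eq_whisker (b ×id) Hg) as Hb.
    cat in Ha. cat in Hb. cat. rewrite Ha, Hb, (comp_assoc c), Hab. now cat. }
  assert (Hevq : forall U (a : U ~> W), ev' ∘ ((q ∘ a) ×id) = ev ∘ (a ×id)).
  { intros U a. rewrite <- Hev'. now cat. }
  exists g'. split.
  - apply (regular_epi_epi (regular_epi_timesl A Hc)).
    rewrite <- Hg, <- Hevq, <- Hg'. now cat.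
  (* A competitor lifts over [P] to a name [k] of the arrow that [g] names, so the classes agree. *)
  - intros g'' Hg''. apply (regular_epi_epi Hc). rewrite Hg'.
    destruct (cover_lift (g'' ∘ c) HP Hq) as [k Hk]. rewrite <- Hk.
    apply HQ'; [exact HP|]. rewrite Hg, <- Hevq, Hk, <- Hg''. now cat.
Qed.

(** [is_exponential] ranges over all products of [T] and [A]; the universal property is carried over
    along the comparison [j] from the chosen one. *)
Lemma exponentials_cartesian_closed : is_cartesian_closed E.
Proof.
  split; [apply finite_limits_terminal, hE|].
  split; [apply finite_limits_products, hE|]. intros A B.
  destruct (exponential A B) as [Q [ev Hev]].
  exists Q, (Q × A), pr1, pr2, ev. split; [apply prd_is_product|].
  intros T P q1 q2 HP f.
  destruct (HP (T × A) pr1 pr2) as [j [[J1 J2] _]].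
  assert (Hj : j ∘ ⟨q1, q2⟩ = idm P).
  { destruct (HP P q1 q2) as [i [_ Hi]].
    rewrite <- (Hi (idm P)), <- (Hi (j ∘ ⟨q1, q2⟩)); try split;
      rewrite ?comp_assoc, ?J1, ?J2; now cat. }
  destruct (Hev T (f ∘ j)) as [g [Hg Hg']]. exists g. split.
  - intros m H1 H2.
    rewrite <- (comp_idr f), <- Hj, comp_assoc, <- Hg, <- comp_assoc. f_equal.
    apply prd_ext; cat; assumption.
  - intros g'' H. apply Hg'. rewrite <- (H ⟨g'' ∘ q1, q2⟩); cat; try reflexivity.
    now rewrite J1, J2.
Qed.

End Exponentials.

(** * Weak simple products from exponentials *)

Lemma chosen_exponential (A B : E) : is_cartesian_closed E ->
  exists (Q : E) (ev : Q × A ~> B), forall T (f : T × A ~> B),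
    exists! g : T ~> Q, ev ∘ (g ×id) = f.
Proof.
  intros [_ [_ hexp]].
  destruct (hexp A B) as [Q [P [p1 [p2 [ev [HP Hev]]]]]].
  destruct (HP (Q × A) pr1 pr2) as [j [[J1 J2] _]].
  exists Q, (ev ∘ j). intros T f.
  destruct (Hev T (T × A) pr1 pr2 (prd_is_product T A) f) as [g [Hg Hg']].
  exists g. split.
  - rewrite <- comp_assoc. apply Hg; rewrite comp_assoc, ?J1, ?J2; now cat.
  - intros g'' H. apply Hg'. intros m H1 H2. rewrite <- H, <- comp_assoc. f_equal.
    destruct (HP _ (g'' ∘ pr1) pr2) as [u [_ Hu]].
    rewrite <- (Hu m), <- (Hu (j ∘ _)); auto.
    rewrite !comp_assoc, J1, J2. now cat.
Qed.

Lemma section_classifier (X Y Z : E) (g1 : Y ~> Z) (g2 : Y ~> X) :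
  is_cartesian_closed E ->
  exists (W : E) (w : W ~> Z) (e : W × X ~> Y),
    g1 ∘ e = w ∘ pr1 /\ g2 ∘ e = pr2 /\
    forall T (t : T ~> Z) (f : T × X ~> Y), g1 ∘ f = t ∘ pr1 -> g2 ∘ f = pr2 ->
      exists h : T ~> W, w ∘ h = t /\ e ∘ (h ×id) = f.
Proof.
  intros hcc.
  destruct (chosen_exponential X Y hcc) as [F [ev HF]].
  destruct (chosen_exponential X (Z × X) hcc) as [G [evG HG]].
  (* Here [F] is [Y ^ X] and [G] is [(Z × X) ^ X]. On [(z, φ)], [a] gives [φ] followed by [⟨g1, g2⟩]
     and [b] gives the arrow pairing [z] with its argument; they agree exactly when [φ] is a section
     over [{z} × X]. *)
  destruct (HG (Z × F) (⟨g1, g2⟩ ∘ ev ∘ (pr2 ×id))) as [a [Ha _]].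
  destruct (HG (Z × F) (pr1 ×id)) as [b [Hb _]].
  destruct (finite_limits_equalisers (proj1 hE) a b) as [W [i [Hi HW]]].
  assert (Hab : ⟨g1, g2⟩ ∘ ev ∘ ((pr2 ∘ i) ×id) = (pr1 ∘ i) ×id).
  { pose proof (comp_eq_whisker (i ×id) Ha) as H1.
    pose proof (f_equal (fun y => y ∘ (i ×id)) Hb) as H2.
    simpl in H2. cat in H1. cat in H2. cat.
    rewrite <- H1, <- H2, (comp_assoc a), Hi, (comp_assoc b). reflexivity. }
  exists W, (pr1 ∘ i), (ev ∘ ((pr2 ∘ i) ×id)).
  pose proof (f_equal (fun y => pr1 ∘ y) Hab) as H1.
  pose proof (f_equal (fun y => pr2 ∘ y) Hab) as H2.
  simpl in H1, H2. cat in H1. cat in H2.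
  split; [now cat|split; [now cat|]].
  intros T t f T1 T2.
  destruct (HF T f) as [φ [Hφ _]].
  destruct (HW T ⟨t, φ⟩) as [h [Hh _]].
  - destruct (HG T (t ×id)) as [u [_ Hu]].
    rewrite <- (Hu (a ∘ ⟨t, φ⟩)), <- (Hu (b ∘ ⟨t, φ⟩)); [reflexivity| |].
    + pose proof (f_equal (fun y => y ∘ (⟨t, φ⟩ ×id)) Hb) as H. simpl in H. cat in H. now cat.
    + pose proof (comp_eq_whisker (⟨t, φ⟩ ×id) Ha) as H. cat in H. cat.
      now rewrite H, Hφ, T1, T2.
  - exists h. rewrite <- comp_assoc, Hh. split; [now cat|].
    rewrite <- Hφ. cat. rewrite (comp_assoc i), Hh. now cat.
Qed.

Lemma cartesian_closed_weak_simple_products :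
  is_cartesian_closed E -> has_weak_simple_products C.
Proof.
  intros hcc [X HX] [Y HY] [Z HZ] g1 g2. simpl in *.
  destruct (section_classifier g1 g2 hcc) as [W0 [w0 [e0 [H1 [H2 Hu]]]]].
  (* Two covers bring the classifier into [C]; the evaluation on [V] factors through [W × X], hence
     is determined by projections. *)
  destruct (cover W0) as [W [q [HW Hq]]].
  destruct (cover (W × X)) as [V [v [HV Hv]]].
  unshelve eexists (@WspData C (exist S X HX) (exist S Y HY) (exist S Z HZ) g1 g2
    (exist S W HW) (w0 ∘ q) (exist S V HV) (pr1 ∘ v) (pr2 ∘ v) (e0 ∘ (q ×id) ∘ v)
    (@cover_weak_product (exist S W HW) (exist S X HX) (exist S V HV) v Hv) _ _ _).
  - intros [U HU] a b; simpl. rewrite <- !comp_assoc. intros Ha Hb.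
    do 2 f_equal. now apply prd_ext.
  - simpl. rewrite !comp_assoc, H1. now cat.
  - simpl. rewrite !comp_assoc, H2. now cat.
  - intros D.
    destruct D as [W' w' V' q1 q2 e Hw Hd Hc1 Hc2].
    (* The competing [e] becomes a section on [W' × X], which [W0] classifies; projectivity of [W']
       and [V'] then gives the arrows to [W] and [V]. *)
    destruct (determined_factors Hw Hd) as [f Hf].
    pose proof (fun T a b => @weak_product_epi _ _ _ _ _ T a b Hw) as Depi.
    destruct W' as [W' HW'], V' as [V' HV']; simpl in *.
    destruct (Hu W' w' f) as [h0 [Hh1 Hh2]].
    { apply Depi. rewrite <- !comp_assoc, Hf. now cat. }
    { apply Depi. rewrite <- !comp_assoc, Hf. now cat. }
    destruct (cover_lift h0 HW' Hq) as [h Hh].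
    destruct (cover_lift ⟨h ∘ q1, q2⟩ HV' Hv) as [k Hk].
    exists h, k. rewrite <- !comp_assoc, Hk, Hh. split; [exact Hh1|].
    split; [now cat|split; [now cat|]].
    rewrite <- Hf, <- Hh2, <- Hh. now cat.
Qed.

End Exact.

Theorem theorem4p13 (E : category) (hE : is_exact E)
    (S : E -> Prop) (hS : is_projective_cover S)
    (h : (forall P : E, is_projective P -> is_internally_projective P)
         \/ has_binary_products (full_subcategory (@is_projective E))
         \/ weak_products_have_determined_idempotents (full_subcategory S)) :
  is_cartesian_closed E <-> has_weak_simple_products (full_subcategory S).
Proof.
  destruct (choose_products (finite_limits_products (proj1 hE))) as [PR].
  split.
  - now apply cartesian_closed_weak_simple_products.
  - apply exponentials_cartesian_closed; [exact hE|exact hS|].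
    now apply products_projective.
Qed.
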